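(* Let $\{P_\theta:\theta\in\Theta\subseteq\mathbb{R}^d\}$ be an exponential family with natural parameter $\theta$ and sufficient statistic $\phi$. Then for all $\theta^*,\theta\in\Theta$, $$A(P_{\theta^*},P_\theta)\le e^{-c\|\theta-\theta^*\|^2},\qquad\text{where } c:=\frac18\inf_{\tilde\theta\in\Theta}\lambda_d\big(\mathrm{Cov}_{X\sim P_{\tilde\theta}}\,\phi(X)\big).$$
   Context: The exponential family has densities $p_\theta(x)=r(x)e^{\theta'\phi(x)-\psi(\theta)}$ with carrier function $r$ and log-partition function $\psi$, with respect to a dominating measure (Lebesgue or counting measure). The Hellinger affinity is $A(P,Q)=\int\sqrt{p(x)q(x)}\,dx$, where $p,q$ are the densities of $P,Q$. $\lambda_j(\cdot)$ denotes the $j$th largest eigenvalue of a symmetric matrix, so $\lambda_d$ of a $d\times d$ matrix is its smallest eigenvalue; $\mathrm{Cov}_{X\sim P_{\tilde\theta}}\phi(X)$ is the covariance matrix of $\phi(X)$ when $X\sim P_{\tilde\theta}$.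
   Formalization: The parameter set Θ is assumed convex (as the full natural parameter space is); for non-convex Θ the claim fails, e.g. a three-point family on {-K,0,K} with base weights w,1,w and Θ={±log(1/w)/K} for small w. *)

(* Defs.v *)
From HB Require Import structures.
From mathcomp Require Import all_boot all_order all_algebra.
From mathcomp Require Import all_classical all_reals all_analysis.

Set Implicit Arguments.
Unset Strict Implicit.
Unset Printing Implicit Defensive.

Import Order.TTheory GRing.Theory Num.Theory.

Local Open Scope classical_set_scope.
Local Open Scope ring_scope.

Section vectors_and_eigenvalues.
Context {R : realType}.

Definition dotv d (u v : 'rV[R]_d) : R := \sum_(i < d) u 0 i * v 0 i.

(* The norm `|v| carried by matrices in the library is the sup norm. *)
Definition l2norm d (v : 'rV[R]_d) : R := Num.sqrt (\sum_(i < d) v 0 i ^+ 2).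

(* The eigenvalues of M with multiplicity, in decreasing order. Such a sequence
   is unique when it exists, and it exists for every symmetric M; it is [::]
   when the characteristic polynomial does not split over R. *)
Definition eigenvalues d (M : 'M[R]_d) : seq R :=
  xget [::] [set s | sorted >=%R s /\
                     char_poly M = \prod_(a <- s) ('X - a%:P)].

(* The j-th largest eigenvalue, counted from j = 1. *)
Definition lambda (j : nat) d (M : 'M[R]_d) : R := (eigenvalues M)`_j.-1.

End vectors_and_eigenvalues.

Section exponential_families.
Context {disp : measure_display} {T : measurableType disp} {R : realType}.

(* psi(theta) = log of the integral of r(x) exp(theta' phi(x)) *)
Definition log_partition d (mu : {measure set T -> \bar R}) (r : T -> R)
    (phi : T -> 'rV[R]_d) (theta : 'rV[R]_d) : R :=
  ln (fine (\int[mu]_x (r x * expR (dotv theta (phi x)))%:E)%E).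

Definition expfam_density d (mu : {measure set T -> \bar R}) (r : T -> R)
    (phi : T -> 'rV[R]_d) (theta : 'rV[R]_d) (x : T) : R :=
  r x * expR (dotv theta (phi x) - log_partition mu r phi theta).

(* P restricted to Theta is the exponential family with carrier r and
   sufficient statistic phi, dominated by mu. As each P theta has mass 1, the
   last clause forces the integral in log_partition to be positive and finite
   on Theta, i.e. Theta lies in the natural parameter space. *)
Definition exponential_family d (mu : {measure set T -> \bar R}) (r : T -> R)
    (phi : T -> 'rV[R]_d) (Theta : set 'rV[R]_d)
    (P : 'rV[R]_d -> probability T R) : Prop :=
  [/\ (forall x, 0 <= r x),
      measurable_fun setT r,
      (forall i, measurable_fun setT (fun x => phi x 0 i)) &
      (forall theta, Theta theta -> forall A, measurable A ->
        P theta A =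
          (\int[mu]_(x in A) (expfam_density mu r phi theta x)%:E)%E)].

Definition hellinger_affinity (mu : {measure set T -> \bar R})
    (p q : T -> R) : \bar R :=
  (\int[mu]_x (Num.sqrt (p x * q x))%:E)%E.

(* The diagonal entry is +oo, read as 0 by fine, exactly when the component has
   an infinite second moment; the smallest eigenvalue is then at most 0. *)
Definition covariance_matrix d (P : probability T R) (phi : T -> 'rV[R]_d) :
    'M[R]_d :=
  \matrix_(i, j) fine (covariance P (fun x => phi x 0 i) (fun x => phi x 0 j)).

End exponential_families.

(* Main.v *)
Require Import Defs.
From HB Require Import structures.
From mathcomp Require Import all_boot all_order all_algebra.
From mathcomp Require Import all_classical all_reals all_analysis.
From mathcomp Require Import measurable_realfun.
From mathcomp Require Import complex.
From mathcomp Require Import ring lra.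

(** The geometric mean of the densities at a and b is proportional to the density
    at the midpoint m, so the affinity is
    exp (psi m - (psi a + psi b) / 2), where psi is the log-partition function
    [hellinger_affinity_expfam]. The theorem therefore says that psi is strongly
    convex, with modulus the smallest eigenvalue of the covariance of phi, which
    is the Hessian of psi.

    The proof avoids differentiating under the integral sign, and so also holds
    up to the boundary of Theta. For a step v around a parameter m,
    psi (m + v) + psi (m - v) - 2 psi m is the logarithm of
    E[e^(v . phi)] E[e^(-v . phi)] under P m, and this product is at least
    1 + Var (v . phi), by e^w + e^-w >= 2 + w^2 after centering
    [mgf_product_ge, log_partition_second_difference]. This local bound is sharp
    to second order as the step tends to 0, and second differences of large step
    are sums of second differences of half the step; iterating the halving
    recovers the exact constant in the limit [second_difference_ge].

    The variance of v . phi is the quadratic form of the covariance matrix at v,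
    which dominates lambda_d |v|^2 by the spectral theorem
    [lambda_le_quadratic_form]. If c > 0, all diagonal entries of the covariance
    matrices are positive, hence genuine finite variances, so that this
    computation makes sense. If c <= 0, the bound is weaker than the bound by 1
    [hellinger_affinity_le1]. *)

Set Implicit Arguments.
Unset Strict Implicit.
Unset Printing Implicit Defensive.

Import Order.TTheory GRing.Theory Num.Theory.

Local Open Scope classical_set_scope.
Local Open Scope ring_scope.

(** * Spectrum of a real symmetric matrix *)

Section symmetric_matrices.
Local Open Scope sesquilinear_scope.

(** A real symmetric matrix is Hermitian over the complexes, where unitary
    diagonalization holds with a real spectrum. The quadratic form
    of a real vector is then read off from the squared moduli of its complex
    coordinates. *)
Lemma spectral_symmetric (R : realType) (d : nat) (M : 'M[R]_d) : M^T = M ->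
  exists e : 'rV[R]_d, exists2 U : 'M[R[i]]_d, U \is unitarymx &
    map_mx (real_complex R) M =
      U^t* *m diag_mx (map_mx (real_complex R) e) *m U.
Proof.
move=> Msym; set A := map_mx _ M.
have Aherm : A \is hermsymmx.
  apply: realsym_hermsym.
    apply/is_hermitianmxP; rewrite expr0 scale1r map_mx_id //.
    by rewrite /A map_trmx Msym.
  by apply/mxOverP => i j; rewrite mxE; apply/complex_realP; exists (M i j).
have Dreal := hermitian_spectral_diag_real Aherm.
have /orthomx_spectralP AE := hermitian_normalmx Aherm.
exists (map_mx (@complex.Re R) (spectral_diag A)), (spectralmx A).
  exact: spectral_unitarymx.
have -> : map_mx (real_complex R) (map_mx (@complex.Re R) (spectral_diag A)) =
    spectral_diag A.
  by apply/matrixP => i j; rewrite !mxE RRe_real //; exact: (mxOverP Dreal).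
by rewrite -invmx_unitary ?spectral_unitarymx.
Qed.

Lemma char_poly_conj (F : fieldType) d (U A : 'M[F]_d) : U \in unitmx ->
  char_poly (invmx U *m A *m U) = char_poly A.
Proof.
move=> Uu; rewrite /char_poly.
have PU : map_mx polyC (invmx U) *m map_mx polyC U = 1%:M.
  by rewrite -map_mxM mulVmx // map_mx1.
have -> : char_poly_mx (invmx U *m A *m U) =
    map_mx polyC (invmx U) *m char_poly_mx A *m map_mx polyC U.
  rewrite /char_poly_mx mulmxBr mulmxBl -!map_mxM; congr (_ - _).
  by rewrite scalar_mxC -mulmxA PU mulmx1.
by rewrite !det_mulmx mulrAC -det_mulmx PU det1 mul1r.
Qed.

Lemma char_poly_spectral (R : realType) d (M : 'M[R]_d) (e : 'rV[R]_d)
    (U : 'M[R[i]]_d) :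
  U \is unitarymx ->
    map_mx (real_complex R) M =
      U^t* *m diag_mx (map_mx (real_complex R) e) *m U ->
  char_poly M = \prod_(i < d) ('X - (e 0 i)%:P).
Proof.
move=> Uu ME.
apply: (map_poly_inj (real_complex R)).
rewrite map_char_poly [X in char_poly X]ME -invmx_unitary //.
rewrite char_poly_conj ?unitarymx_unit// char_poly_trig ?diag_mx_is_trig//.
rewrite rmorph_prod; apply: eq_bigr => i _.
by rewrite !mxE eqxx mulr1n rmorphB /= map_polyX map_polyC.
Qed.

(** The factorization by e shows that the sequences selecting the eigenvalues
    form a nonempty set; two factorizations have the same roots, and the last
    of the d sorted roots is the smallest one. *)
Lemma lambda_le_spectrum (R : realType) d (M : 'M[R]_d) (e : 'rV[R]_d) i :
  char_poly M = \prod_(i < d) ('X - (e 0 i)%:P) -> lambda d M <= e 0 i.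
Proof.
move=> Me.
have [srt chs] : [set s | sorted >=%R s /\
                     char_poly M = \prod_(a <- s) ('X - a%:P)] (eigenvalues M).
  rewrite /eigenvalues; apply: (@xgetPex _ [::]).
  exists (sort >=%R [seq e 0 i | i <- enum 'I_d]); split.
    by apply: sort_sorted => x y; rewrite orbC le_total.
  rewrite (perm_big _ (permEl (perm_sort _ _))) big_map Me.
  by rewrite big_enum.
have szs : size (eigenvalues M) = d.
  have := size_char_poly M.
  by rewrite chs size_prod_XsubC => -[].
have ies : e 0 i \in eigenvalues M.
  rewrite -root_prod_XsubC -chs Me.
  rewrite /root horner_prod (bigD1 i) //= hornerXsubC subrr mul0r //.
rewrite /lambda.
have := sorted_leq_nth (rev_trans le_trans) lexx 0 srt.
move=> /(_ (index (e 0 i) (eigenvalues M)) d.-1).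
rewrite nth_index //; apply.
- by rewrite inE index_mem.
- by rewrite inE szs prednK // (leq_ltn_trans _ (ltn_ord i)).
- have : (index (e 0%R i) (eigenvalues M) < size (eigenvalues M))%N by rewrite index_mem.
  by rewrite szs => lt_d; rewrite -ltnS (ltn_predK lt_d).
Qed.

(** In the unitary coordinates g of h, the quadratic form is the sum of the
    e_i |g_i|^2 and the squared norm is the sum of the |g_i|^2. *)
Lemma lambda_le_quadratic_form (R : realType) d (M : 'M[R]_d) (h : 'rV[R]_d) :
  M^T = M -> lambda d M * l2norm h ^+ 2 <= (h *m M *m h^T) 0 0.
Proof.
move=> /spectral_symmetric[e [U Uu ME]].
have lame i := lambda_le_spectrum i (char_poly_spectral Uu ME).
pose H := map_mx (real_complex R) h.
pose g := H *m U^t*.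
have hE : H^t* = H^T.
  apply/matrixP => i j; rewrite !mxE; apply/CrealP/complex_realP.
  by exists (h j i).
have gE : g^t* = U *m H^T.
  by rewrite /g trmx_mul map_mxM trmxCK hE.
have nrm : (\sum_i h 0 i ^+ 2)%:C%C = \sum_i `|g 0 i| ^+ 2.
  transitivity ((g *m g^t*) 0 0).
    rewrite gE /g mulmxA mulmxKtV// mxE rmorph_sum.
    by apply: eq_bigr => i _; rewrite !mxE -rmorphM.
  rewrite mxE; apply: eq_bigr => i _.
  by rewrite [X in _ * X]mxE [g^T _ _]mxE -normCK.
have qf : ((h *m M *m h^T) 0 0)%:C%C = \sum_i (e 0 i)%:C%C * `|g 0 i| ^+ 2.
  transitivity ((g *m diag_mx (map_mx (real_complex R) e) *m g^t*) 0 0).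
    rewrite gE /g !mulmxA -!(mulmxA H) -ME mulmxA.
    by rewrite /H map_trmx -!map_mxM [RHS]mxE.
  rewrite mxE; apply: eq_bigr => i _.
  rewrite [X in _ * X]mxE [g^T _ _]mxE mul_mx_diag [X in X * _]mxE.
  by rewrite [map_mx _ e _ _]mxE mulrAC -normCK mulrC.
rewrite /l2norm sqr_sqrtr ?sumr_ge0// => [|i _]; last exact: sqr_ge0.
rewrite -lecR rmorphM /= nrm qf mulr_sumr; apply: ler_sum => i _.
by rewrite ler_wpM2r ?exprn_ge0// lecR.
Qed.

End symmetric_matrices.

(** * Second differences and strong convexity *)

Lemma expR_ge_quadratic (R : realType) (y : R) : 0 <= y ->
  1 + y + y ^+ 2 / 2 <= expR y.
Proof.
move=> y0.
have -> : 1 + y + y ^+ 2 / 2 = series (exp_coeff y) 3.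
  rewrite /series /= !big_nat_recr //= big_nil /exp_coeff /= expr0 expr1.
  by rewrite !factS fact0 !muln1 /= !divr1 add0r.
apply: nondecreasing_cvgn_le; last exact: is_cvg_series_exp_coeff.
apply/nondecreasing_seqP => n; rewrite /series /= big_nat_recr //= lerDl.
by rewrite /exp_coeff /= divr_ge0 ?exprn_ge0.
Qed.

(** With y = x / 2 and p = e^y, the claim is (2 y)^2 <= (p - 1/p)^2. It follows
    from p >= 1 + y + y^2/2, since p - 1/p increases with p. *)
Lemma expRD_expRN_ge (R : realType) (x : R) :
  2 + x ^+ 2 <= expR x + expR (- x).
Proof.
wlog x0 : x / 0 <= x => [H|].
  have [|/ltW] := leP 0 x; first exact: H.
  by rewrite -oppr_ge0 => /H; rewrite sqrrN opprK [X in _ <= X]addrC.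
pose y := x / 2.
have y0 : 0 <= y by rewrite divr_ge0.
have -> : x = y + y by rewrite /y; field.
rewrite opprD !expRD !expRN.
set p := expR y.
have p0 : 0 < p := expR_gt0 y.
have pge := expR_ge_quadratic y0; rewrite -/p in pge.
have ppV : p * p^-1 = 1 by rewrite mulfV// gt_eqF.
suff le_yp : 2 * y <= p - p^-1.
  have : 0 <= (p - p^-1 - 2 * y) * (p - p^-1 + 2 * y) by apply: mulr_ge0; lra.
  nra.
rewrite -(ler_pM2r p0) mulrBl mulVf ?gt_eqF//.
nra.
Qed.

Lemma ln1D_ge (R : realType) (x : R) : 0 <= x -> x <= ln (1 + x) * (1 + x).
Proof.
move=> x0; have x1 : 0 < 1 + x by lra.
rewrite -ler_pdivrMr// -lerN2 -lnV//.
rewrite [X in ln X](_ : _ = 1 + (- (x / (1 + x)))); last by field; rewrite gt_eqF.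
apply: le_ln1Dx; rewrite ltrN2 ltr_pdivrMr//; lra.
Qed.

(** A convexity modulus without derivatives. The second difference of step 2e
    is the sum of four second differences of step e (the central one counted
    twice), so halving the step n times turns the hypothesis into the lower
    bound 4^n ln (1 + e^2 K / 4^n), which tends to e^2 K; the conclusion is
    the case of step 1/2 at the midpoint 1/2. *)
Lemma second_difference_ge (R : realType) (g : R -> R) (K : R) : 0 <= K ->
  (forall m e, 0 <= e -> 0 <= m - e -> m + e <= 1 ->
     ln (1 + e ^+ 2 * K) <= g (m + e) + g (m - e) - 2 * g m) ->
  K / 4 <= g 1 + g 0 - 2 * g 2^-1.
Proof.
move=> K0 H.
have Hn n m e : 0 <= e -> 0 <= m - e -> m + e <= 1 ->
   4 ^+ n * ln (1 + (e / 2 ^+ n) ^+ 2 * K) <= g (m + e) + g (m - e) - 2 * g m.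
  elim: n m e => [|n IH] m e e0 me0 me1.
    by rewrite !expr0 mul1r divr1; exact: H.
  have e2 : 0 <= e / 2 by rewrite divr_ge0.
  have := IH m (e / 2) e2; have := IH (m + e / 2) (e / 2) e2.
  have := IH (m - e / 2) (e / 2) e2.
  have -> : m - e / 2 - e / 2 = m - e by field.
  have -> : m - e / 2 + e / 2 = m by field.
  have -> : m + e / 2 + e / 2 = m + e by field.
  have -> : m + e / 2 - e / 2 = m by field.
  have -> : e / 2 / 2 ^+ n = e / 2 ^+ n.+1 by rewrite exprS invfM mulrA.
  rewrite (exprS 4); set L := 4 ^+ n * _.
  move=> /(_ ltac:(lra) ltac:(lra)) h1 /(_ ltac:(lra) ltac:(lra)) h2.
  move=> /(_ ltac:(lra) ltac:(lra)) h3.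
  rewrite -mulrA -/L; lra.
set S := _ - _.
(* ln (1 + x) >= x / (1 + x) for x = K / 4 / 4^n gives K / 4 <= S (1 + x). *)
have SS n : K / 4 <= S * (1 + K / 4 / 4 ^+ n).
  have := Hn n 2^-1 2^-1; rewrite subrr.
  have -> : (2^-1 + 2^-1 : R) = 1 by field.
  move=> /(_ ltac:(lra) ltac:(lra) ltac:(lra)); rewrite -/S.
  have -> : (2^-1 / 2 ^+ n) ^+ 2 * K = K / 4 / 4 ^+ n.
    rewrite expr_div_n -exprM mulnC exprM.
    have -> : (2 ^+ 2 : R) = 4 by ring.
    have : (4 : R) ^+ n != 0 by rewrite expf_neq0.
    by move=> ?; field.
  set x := K / 4 / 4 ^+ n => le_S.
  have p4 : 0 < (4 : R) ^+ n by rewrite exprn_gt0.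
  have x0 : 0 <= x by rewrite !divr_ge0// ltW.
  have -> : K / 4 = 4 ^+ n * x by rewrite /x [RHS]mulrC divfK// gt_eqF.
  rewrite (le_trans (ler_wpM2l (ltW p4) (ln1D_ge x0)))// mulrA.
  by rewrite ler_wpM2r// addr_ge0.
(* If S < K / 4, then 4^n (K / 4 - S) stays below S K / 4 for all n. *)
rewrite leNgt; apply/negP => S_lt.
have d0 : 0 < K / 4 - S by lra.
have K4 : 0 <= K / 4 by rewrite divr_ge0.
have S0 : 0 <= S.
  by have := SS 0; rewrite expr0 divr1 => h; rewrite -(@pmulr_lge0 _ (1 + K / 4)); lra.
have := archi_boundP (divr_ge0 (mulr_ge0 S0 K4) (ltW d0)).
set n := Num.bound _; rewrite ltr_pdivrMr// ltNge => /negP; apply.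
have n4 : n%:R <= 4 ^+ n :> R by rewrite -natrX ler_nat ltnW// ltn_expl.
have p4 : 0 < (4 : R) ^+ n by rewrite exprn_gt0.
rewrite (le_trans (ler_wpM2r (ltW d0) n4))// mulrC -ler_pdivlMr//.
have := SS n; rewrite mulrDr mulr1 mulrA; lra.
Qed.

(** * Moments and covariances of square-integrable variables *)

Section moments.
Context {disp : measure_display} {T : measurableType disp} {R : realType}.
Variable P : probability T R.

Lemma Lfun2_Lfun1 (X : T -> R) : X \in Lfun P 2%:E -> X \in Lfun P 1.
Proof. by apply: Lfun_subset12; exact: fin_num_measure. Qed.

Lemma Lfun2D (X Y : T -> R) : X \in Lfun P 2%:E -> Y \in Lfun P 2%:E ->
  X \+ Y \in Lfun P 2%:E.
Proof. by move=> X2 Y2; rewrite rpredD ?lee1n. Qed.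

Lemma mem_Lfun_measurable p (X : T -> R) : X \in Lfun P p -> measurable_fun setT X.
Proof. by rewrite inE => /andP[]; rewrite inE. Qed.

Lemma Lfun1_ge0 (Y : T -> R) (y : R) : measurable_fun setT Y ->
  (forall x, 0 <= Y x) -> (\int[P]_x (Y x)%:E)%E = y%:E -> Y \in Lfun P 1.
Proof.
move=> mY Y0 Yy; apply/Lfun1_integrable/integrableP; split.
  exact/measurable_EFinP.
under eq_integral do rewrite /= ger0_norm//.
by rewrite Yy ltry.
Qed.

Lemma expectation_le1 (X Y : T -> R) : X \in Lfun P 1 -> Y \in Lfun P 1 ->
  (forall x, X x <= Y x) -> fine 'E_P[X] <= fine 'E_P[Y].
Proof.
move=> X1 Y1 XY.
rewrite fine_le ?expectation_fin_num//.
rewrite unlock le_integral//; try exact/Lfun1_integrable.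
by move=> x _; rewrite lee_fin.
Qed.

Lemma fine_expectationD (X Y : T -> R) : X \in Lfun P 1 -> Y \in Lfun P 1 ->
  fine 'E_P[X \+ Y] = fine 'E_P[X] + fine 'E_P[Y].
Proof. by move=> X1 Y1; rewrite expectationD// fineD ?expectation_fin_num. Qed.

Lemma fine_expectationZ (X : T -> R) k : X \in Lfun P 1 ->
  fine 'E_P[k \o* X] = k * fine 'E_P[X].
Proof. by move=> X1; rewrite expectationZl// fineM ?expectation_fin_num. Qed.

(** Centering X multiplies the two exponential moments by e^-m and e^m and so
    keeps their product. After centering they are 1 + s and 1 + t with
    s, t >= 0, because e^w >= 1 + w, and s + t >= Var X, because
    e^w + e^-w >= 2 + w^2. Then (1 + s)(1 + t) >= 1 + s + t. *)
Lemma mgf_product_ge (X : T -> R) (a b : R) : X \in Lfun P 2%:E ->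
  (\int[P]_x (expR (X x))%:E)%E = a%:E ->
  (\int[P]_x (expR (- X x))%:E)%E = b%:E ->
  1 + fine (covariance P X X) <= a * b.
Proof.
move=> X2 Ea Eb.
have X1 := Lfun2_Lfun1 X2.
have mX := mem_Lfun_measurable X1.
have e1 : (fun x => expR (X x)) \in Lfun P 1.
  by apply: Lfun1_ge0 Ea => [|x]; [exact: measurableT_comp|exact: expR_ge0].
have e2 : (fun x => expR (- X x)) \in Lfun P 1.
  apply: Lfun1_ge0 Eb => [|x]; last exact: expR_ge0.
  by apply: measurableT_comp => //; exact: measurableT_comp.
have fEa : fine 'E_P[(fun x => expR (X x))] = a by rewrite unlock Ea.
have fEb : fine 'E_P[(fun x => expR (- X x))] = b by rewrite unlock Eb.
set m := fine 'E_P[X].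
have c1 c : cst c \in Lfun P 1 := Lfun_cst P c 1.
have Ec c : fine 'E_P[cst c] = c by rewrite expectation_cst.
pose W := X \+ cst (- m).
have W2 : W \in Lfun P 2%:E by rewrite Lfun2D ?Lfun_cst.
have W1 := Lfun2_Lfun1 W2.
have EW : fine 'E_P[W] = 0.
  by rewrite /W fine_expectationD// Ec subrr.
have WW1 : W \* W \in Lfun P 1 := Lfun2_mul_Lfun1 W2 W2.
have EWW : fine 'E_P[W \* W] = fine (covariance P X X) by rewrite [in RHS]unlock.
pose u := expR (- m) \o* (fun x => expR (X x)).
pose v := expR m \o* (fun x => expR (- X x)).
have u1 : u \in Lfun P 1 by exact: Lfun_scale.
have v1 : v \in Lfun P 1 by exact: Lfun_scale.
have uE x : u x = expR (W x) by rewrite /u /W /= -expRD.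
have vE x : v x = expR (- W x) by rewrite /v /W /= -expRD opprD opprK.
have Eu : fine 'E_P[u] = expR (- m) * a by rewrite fine_expectationZ// fEa.
have Ev : fine 'E_P[v] = expR m * b by rewrite fine_expectationZ// fEb.
have u_ge1 : 1 <= fine 'E_P[u].
  have -> : 1 = fine 'E_P[cst 1 \+ W] by rewrite fine_expectationD// EW Ec addr0.
  apply: expectation_le1 => //; first by rewrite rpredD.
  by move=> x; rewrite uE; exact: expR_ge1Dx.
have v_ge1 : 1 <= fine 'E_P[v].
  have -> : 1 = fine 'E_P[cst 1 \+ (-1) \o* W].
    by rewrite fine_expectationD ?fine_expectationZ ?Lfun_scale// EW Ec mulr0 addr0.
  apply: expectation_le1 => //; first by rewrite rpredD// Lfun_scale.
  by move=> x; rewrite vE /= mulrN1; exact: expR_ge1Dx.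
have uv : 2 + fine (covariance P X X) <= fine 'E_P[u] + fine 'E_P[v].
  have -> : 2 + fine (covariance P X X) = fine 'E_P[cst 2 \+ (W \* W)].
    by rewrite fine_expectationD// EWW Ec.
  rewrite -fine_expectationD//.
  apply: expectation_le1 => //; try by rewrite rpredD.
  move=> x; rewrite /= uE vE -expr2.
  exact: expRD_expRN_ge.
have -> : a * b = fine 'E_P[u] * fine 'E_P[v].
  by rewrite Eu Ev expRN; field; rewrite gt_eqF ?expR_gt0.
nra.
Qed.

(** fine sends an infinite variance to 0, so a positive value certifies a finite
    second moment. *)
Lemma variance_gt0_Lfun2 (X : T -> R) : measurable_fun setT X ->
  0 < fine (covariance P X X) -> X \in Lfun P 2%:E.
Proof.
move=> mX cov0; set m := fine 'E_P[X].
pose W := X \+ cst (- m).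
have mW : measurable_fun setT W by exact: measurable_funD.
have W2 : W \in Lfun P 2%:E.
  rewrite inE; apply/andP; split; rewrite inE//= /finite_norm unlock /Lnorm.
  rewrite poweR_lty//.
  under eq_integral do rewrite /= powR_mulrn// real_normK ?num_real//.
  have -> : (\int[P]_x (W x ^+ 2)%:E)%E = covariance P X X.
    by rewrite covariance.unlock -/m unlock.
  by case: (covariance P X X) cov0 => [r _|/=|/=]; rewrite ?ltxx ?ltry.
have -> : X = W \+ cst m by apply/funext => x; rewrite /W /= subrK.
by rewrite Lfun2D ?Lfun_cst.
Qed.

(** Square integrability of the partial sums is part of the conclusion because
    the additivity of the covariance requires it at each step. *)
Lemma covariance_suml d (X : 'I_d -> T -> R) (h : 'I_d -> R) (Y : T -> R) :
  (forall i, X i \in Lfun P 2%:E) -> Y \in Lfun P 2%:E ->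
  (fun x => \sum_(i < d) h i * X i x) \in Lfun P 2%:E /\
  fine (covariance P (fun x => \sum_(i < d) h i * X i x) Y) =
  \sum_(i < d) h i * fine (covariance P (X i) Y).
Proof.
move=> X2 Y2; elim: (index_enum _) => [|i s [IH2 IH]].
  under eq_fun do rewrite big_nil.
  rewrite big_nil -[fun=> 0]/(cst 0) covariance_cst_l; split=> //.
  exact: Lfun_cst.
have -> : (fun x => \sum_(j <- i :: s) h j * X j x) =
    (h i \o* X i) \+ (fun x => \sum_(j <- s) h j * X j x).
  by apply/funext => x; rewrite big_cons /= mulrC.
have hX2 : h i \o* X i \in Lfun P 2%:E by rewrite Lfun_scale// ler1n.
split; first exact: Lfun2D.
have cfin Z Z' : Z \in Lfun P 2%:E -> Z' \in Lfun P 2%:E ->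
    covariance P Z Z' \is a fin_num.
  move=> Z2 Z'2; apply: covariance_fin_num; try exact: Lfun2_Lfun1.
  exact: Lfun2_mul_Lfun1.
rewrite big_cons covarianceDl// fineD ?cfin// IH; congr (_ + _).
rewrite covarianceZl ?fineM ?cfin//; try exact: Lfun2_Lfun1.
exact: Lfun2_mul_Lfun1.
Qed.

Lemma variance_linear d (phi : T -> 'rV[R]_d) (h : 'rV[R]_d) :
  (forall i, (fun x => phi x 0 i) \in Lfun P 2%:E) ->
  (fun x => dotv h (phi x)) \in Lfun P 2%:E /\
  fine (covariance P (fun x => dotv h (phi x)) (fun x => dotv h (phi x))) =
  (h *m covariance_matrix P phi *m h^T) 0 0.
Proof.
move=> phi2.
have covl Y (Y2 : Y \in Lfun P 2%:E) := covariance_suml (h 0) phi2 Y2.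
have L2 : (fun x => dotv h (phi x)) \in Lfun P 2%:E.
  by case: (covl (cst 0)) => //; exact: Lfun_cst.
split => //; have [_ ->] := covl _ L2.
rewrite mxE; apply: eq_bigr => i _.
rewrite covarianceC; have [_ ->] := covl _ (phi2 i).
rewrite mulrC !mxE; congr (_ * _); apply: eq_bigr => j _.
by rewrite !mxE.
Qed.

End moments.

(** * Integration against a measure with a density *)

Section density.
Context {disp : measure_display} {T : measurableType disp} {R : realType}.
Variables (mu nu : {measure set T -> \bar R}) (p : T -> R).
Hypothesis p0 : forall x, 0 <= p x.
Hypothesis mp : measurable_fun setT p.
Hypothesis nuE : forall A, measurable A -> nu A = (\int[mu]_(x in A) (p x)%:E)%E.

Import HBNNSimple.

(** Only the values of nu on measurable sets are known, so the change of
    measure goes through simple functions. *)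
Lemma nnsfun_integral_density (h : {nnsfun T >-> R}) :
  (\int[nu]_x (h x)%:E = \int[mu]_x (h x * p x)%:E)%E.
Proof.
have hE x : (h x * p x)%:E =
    (\sum_(r \in range h) ((r * \1_(h @^-1` [set r]) x) * p x)%:E)%E.
  by rewrite fsumEFin// -mulr_fsuml -fimfunE.
under [RHS]eq_integral do rewrite hE.
rewrite integralT_nnsfun sintegralE ge0_integral_fsum//; last 2 first.
- move=> r; apply/measurable_EFinP/measurable_funM => //.
  exact: measurable_funM.
- move=> r x _; rewrite EFinM mule_ge0 ?lee_fin//.
  exact: nnfun_muleindic_ge0.
apply: eq_fsbigr => r; rewrite inE => -[y _ <-{r}].
have mh : measurable (h @^-1` [set h y]) by [].
rewrite nuE// integral_mkcond -ge0_integralZl_EFin//; last 2 first.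
- by move=> x _; rewrite patchE; case: ifP => //; rewrite lee_fin.
- apply/(measurable_restrictT _ mh)/measurable_funTS.
  exact/measurable_EFinP.
apply: eq_integral => x _; rewrite patchE indicE.
by case: ifP => _; rewrite ?mulr1 ?mulr0 ?mul0r ?mule0 ?EFinM.
Qed.

Lemma ge0_integral_density (f : T -> R) : (forall x, 0 <= f x) ->
  measurable_fun setT f ->
  (\int[nu]_x (f x)%:E = \int[mu]_x (f x * p x)%:E)%E.
Proof.
move=> f0 mf.
have mEf : measurable_fun setT (EFin \o f) by exact/measurable_EFinP.
pose h := nnsfun_approx measurableT mEf.
have h_f x : (h n x)%:E @[n --> \oo] --> (f x)%:E.
  by apply: (cvg_nnsfun_approx measurableT mEf) => // y _; rewrite lee_fin.
have h_nd x : {homo (fun n => h n x) : m n / (m <= n)%N >-> m <= n}.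
  by move=> m n mn; exact/lefP/(nd_nnsfun_approx measurableT mEf mn).
transitivity (limn (fun n => \int[nu]_x (h n x)%:E)%E).
  rewrite -monotone_convergence//.
  - by apply: eq_integral => x _; apply/esym/cvg_lim.
  - by move=> n; exact/measurable_EFinP.
  - by move=> n x _; rewrite lee_fin.
  - by move=> x _ m n mn; rewrite lee_fin h_nd.
under eq_fun do rewrite nnsfun_integral_density.
rewrite -monotone_convergence//.
- apply: eq_integral => x _; apply/cvg_lim => //.
  under eq_fun do rewrite EFinM.
  by rewrite EFinM; exact: cvgeZr.
- by move=> n; exact/measurable_EFinP/measurable_funM.
- by move=> n x _; rewrite lee_fin mulr_ge0.
- by move=> x _ m n mn; rewrite lee_fin ler_wpM2r// h_nd.
Qed.

End density.

(** * Euclidean vectors *)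

Section vectors.
Context {R : realType} {d : nat}.
Implicit Types u v w : 'rV[R]_d.

Lemma dotvDl u v w : dotv (u + v) w = dotv u w + dotv v w.
Proof. by rewrite /dotv -big_split; apply: eq_bigr => i _; rewrite mxE mulrDl. Qed.

Lemma dotvZl k u w : dotv (k *: u) w = k * dotv u w.
Proof. by rewrite /dotv mulr_sumr; apply: eq_bigr => i _; rewrite mxE mulrA. Qed.

Lemma dotvNl u w : dotv (- u) w = - dotv u w.
Proof. by rewrite -scaleN1r dotvZl mulN1r. Qed.

Lemma l2norm_sqr u : l2norm u ^+ 2 = \sum_(i < d) u 0 i ^+ 2.
Proof. by rewrite /l2norm sqr_sqrtr// sumr_ge0// => i _; exact: sqr_ge0. Qed.

Lemma l2normZ_sqr k u : l2norm (k *: u) ^+ 2 = k ^+ 2 * l2norm u ^+ 2.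
Proof.
by rewrite !l2norm_sqr mulr_sumr; apply: eq_bigr => i _; rewrite mxE exprMn.
Qed.

Lemma convex_set_segment (A : set 'rV[R]_d) u v (t : R) :
  convex_set A -> A u -> A v -> 0 <= t -> t <= 1 -> A (u + t *: (v - u)).
Proof.
move=> cA Au Av t0 t1.
have t01 : Itv.spec (@Itv.num_sem R) (Itv.Real `[0%Z, 1%Z]) t.
  by rewrite /Itv.spec /Itv.num_sem /= num_real in_itv /= t0 t1.
have := cA v u (Itv.mk t01).
rewrite !inE => /(_ Av Au).
suff -> : u + t *: (v - u) = t *: v + (1 - t) *: u by [].
by rewrite scalerBr scalerBl scale1r addrCA.
Qed.

End vectors.

(** * Affinity and log-partition function *)

(** By the AM-GM inequality, sqrt (p q) <= (p + q) / 2 pointwise. *)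
Lemma hellinger_affinity_le1 (disp : measure_display)
    (T : measurableType disp) (R : realType) (mu : {measure set T -> \bar R})
    (p q : T -> R) :
  (forall x, 0 <= p x) -> (forall x, 0 <= q x) ->
  measurable_fun setT p -> measurable_fun setT q ->
  (\int[mu]_x (p x)%:E = 1)%E -> (\int[mu]_x (q x)%:E = 1)%E ->
  (hellinger_affinity mu p q <= 1)%E.
Proof.
move=> p0 q0 mp mq p1 q1; rewrite /hellinger_affinity.
have mEp : measurable_fun setT (fun x => (p x)%:E) by exact/measurable_EFinP.
have mEq : measurable_fun setT (fun x => (q x)%:E) by exact/measurable_EFinP.
have -> : (1%E : \bar R) =
    (\int[mu]_x ((2^-1)%:E * ((p x)%:E + (q x)%:E)))%E.
  rewrite ge0_integralZl_EFin//.
  - rewrite ge0_integralD//; try by move=> x _; rewrite lee_fin.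
    by rewrite p1 q1 -EFinD -EFinM; congr EFin; field.
  - by move=> x _; rewrite adde_ge0// lee_fin.
  - exact: emeasurable_funD.
apply: ge0_le_integral => //.
- apply/measurable_EFinP.
  apply: (@measurableT_comp _ _ _ _ _ _ (@Num.sqrt R)).
    by apply: continuous_measurable_fun; exact: sqrt_continuous.
  exact: measurable_funM.
- by apply: emeasurable_funM => //; exact: emeasurable_funD.
- move=> x _; rewrite -EFinD -EFinM lee_fin.
  have -> : 2^-1 * (p x + q x) = Num.sqrt ((2^-1 * (p x + q x)) ^+ 2).
    by rewrite sqrtr_sqr ger0_norm// mulr_ge0// addr_ge0.
  by rewrite ler_wsqrtr//; have := sqr_ge0 (p x - q x); lra.
Qed.

Section exponential_family.
Context {disp : measure_display} {T : measurableType disp} {R : realType}.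
Variables (mu : {measure set T -> \bar R}) (d : nat) (r : T -> R)
  (phi : T -> 'rV[R]_d) (Theta : set 'rV[R]_d)
  (P : 'rV[R]_d -> probability T R).
Hypothesis famP : exponential_family mu r phi Theta P.
Let p := expfam_density mu r phi.
Let psi := log_partition mu r phi.

Lemma measurable_dotv v : measurable_fun setT (fun x => dotv v (phi x)).
Proof.
by case: famP => _ _ mphi _; apply: measurable_sum => i; exact: measurable_funM.
Qed.

Lemma expfam_density_ge0 t x : 0 <= p t x.
Proof. by case: famP => r0 _ _ _; rewrite /p /expfam_density mulr_ge0// expR_ge0. Qed.

Lemma measurable_expfam_density t : measurable_fun setT (p t).
Proof.
case: famP => _ mr _ _; apply: measurable_funM => //.
by apply: measurableT_comp => //; apply: measurable_funB => //; exact: measurable_dotv.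
Qed.

Lemma expfam_density_mass t : Theta t -> (\int[mu]_x (p t x)%:E = 1)%E.
Proof. by case: famP => _ _ _ PE tT; rewrite -PE// probability_setT. Qed.

(** Tilting by e^(v . phi) moves the density from parameter t to t + v up to
    normalization. *)
Lemma expfam_density_shift t v x :
  p (t + v) x = expR (dotv v (phi x)) * p t x * expR (psi t - psi (t + v)).
Proof.
rewrite /p /expfam_density -/psi dotvDl mulrCA -!mulrA -!expRD.
congr (_ * expR _).
by move: (psi t) (psi _) (dotv t _) (dotv v _) => st stv ut uv; ring.
Qed.

Lemma expfam_mgf m v : Theta m -> Theta (m + v) ->
  (\int[P m]_x (expR (dotv v (phi x)))%:E = (expR (psi (m + v) - psi m))%:E)%E.
Proof.
move=> mT mvT.
have PE := let: And4 _ _ _ PE := famP in PE m mT.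
rewrite (ge0_integral_density (expfam_density_ge0 m) (measurable_expfam_density m) PE).
- have E x : (expR (dotv v (phi x)) * p m x)%:E =
      ((expR (psi (m + v) - psi m))%:E * (p (m + v) x)%:E)%E.
    rewrite expfam_density_shift -EFinM [X in _ = X%:E]mulrCA -expRD.
    by rewrite addrA subrK subrr expR0 mulr1.
  under eq_integral do rewrite E.
  rewrite ge0_integralZl_EFin ?expR_ge0// ?expfam_density_mass ?mule1//.
  + by move=> x _; rewrite lee_fin expfam_density_ge0.
  + exact/measurable_EFinP/measurable_expfam_density.
- by move=> x; exact: expR_ge0.
- by apply: measurableT_comp => //; exact: measurable_dotv.
Qed.

(** The geometric mean of the densities at a and b is proportional to the
    density at the midpoint, which has mass 1. *)
Lemma hellinger_affinity_expfam a b m : m = 2^-1 *: (a + b) -> Theta m ->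
  hellinger_affinity mu (p a) (p b) = (expR (psi m - (psi a + psi b) / 2))%:E.
Proof.
move=> mE mT; rewrite /hellinger_affinity.
set C := expR _.
have E x : (Num.sqrt (p a x * p b x))%:E = (C%:E * (p m x)%:E)%E.
  rewrite -EFinM; congr EFin.
  have -> : p a x * p b x = (C * p m x) ^+ 2.
    rewrite /C /p /expfam_density -/psi mE dotvZl dotvDl.
    rewrite mulrACA [in RHS]mulrCA -!expRD exprMn -expRM_natl -expr2.
    congr (_ * expR _); rewrite -/psi.
    (* field would otherwise unfold the log-partition function *)
    move: (psi a) (psi b) (psi _) (dotv a _) (dotv b _) => sa sb sm ua ub.
    by field.
  by rewrite sqrtr_sqr ger0_norm// mulr_ge0 ?expR_ge0 ?expfam_density_ge0.
under eq_integral do rewrite E.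
rewrite ge0_integralZl_EFin ?expR_ge0// ?expfam_density_mass ?mule1//.
- by move=> x _; rewrite lee_fin expfam_density_ge0.
- exact/measurable_EFinP/measurable_expfam_density.
Qed.

(** The exponential of the second difference is the product of the moments of
    e^(v . phi) and e^(-v . phi) under P m, and the quadratic form is the
    variance of v . phi under P m. *)
Lemma log_partition_second_difference m v :
  (forall i, (fun x => phi x 0 i) \in Lfun (P m) 2%:E) ->
  Theta m -> Theta (m + v) -> Theta (m - v) ->
  ln (1 + (v *m covariance_matrix (P m) phi *m v^T) 0 0) <=
  psi (m + v) + psi (m - v) - 2 * psi m.
Proof.
move=> phi2 mT mvT mvT'.
have [v2 <-] := variance_linear v phi2.
have mgfN : (\int[P m]_x (expR (- dotv v (phi x)))%:E =
    (expR (psi (m - v) - psi m))%:E)%E.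
  by have := expfam_mgf mT mvT'; under eq_integral do rewrite dotvNl.
have := mgf_product_ge v2 (expfam_mgf mT mvT) mgfN.
rewrite -expRD.
move: (psi m) (psi (m + v)) (psi (m - v)) => s0 s1 s2 le_exp.
have -> : s1 + s2 - 2 * s0 = ln (expR (s1 - s0 + (s2 - s0))).
  by rewrite expRK; ring.
rewrite ler_ln ?posrE ?expR_gt0//.
by rewrite ltr_pwDl// fine_ge0// variance_ge0.
Qed.

End exponential_family.

Theorem mainTheorem4 (R : realType) (disp : measure_display)
    (T : measurableType disp) (mu : {measure set T -> \bar R}) (d : nat)
    (r : T -> R) (phi : T -> 'rV[R]_d) (Theta : set 'rV[R]_d)
    (P : 'rV[R]_d -> probability T R)
    (Theta_convex : convex_set Theta)
    (P_expfam : exponential_family mu r phi Theta P)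
    (c : R)
    (c_def : c = 8^-1 *
       inf [set lambda d (covariance_matrix (P theta') phi) | theta' in Theta])
    (thetas theta : 'rV[R]_d) (thetas_in : Theta thetas)
    (theta_in : Theta theta) :
  (hellinger_affinity mu (expfam_density mu r phi thetas)
                         (expfam_density mu r phi theta)
   <= (expR (- c * l2norm (theta - thetas) ^+ 2))%:E)%E.
Proof.
set h := theta - thetas.
(* For c <= 0 the right-hand side is at least 1. *)
have [c_le0|c_gt0] := leP c 0.
  apply: (@le_trans _ _ 1%E).
    apply: hellinger_affinity_le1.
    - exact: expfam_density_ge0 P_expfam _.
    - exact: expfam_density_ge0 P_expfam _.
    - exact: measurable_expfam_density P_expfam _.
    - exact: measurable_expfam_density P_expfam _.
    - exact: expfam_density_mass P_expfam _ thetas_in.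
    - exact: expfam_density_mass P_expfam _ theta_in.
  by rewrite lee_fin -[leLHS]expR0 ler_expR mulr_ge0 ?oppr_ge0 ?sqr_ge0.
(* inf is 0 on a set that is not bounded below, so c > 0 makes 8 c a lower
   bound. *)
have lambda_ge t : Theta t -> 8 * c <= lambda d (covariance_matrix (P t) phi).
  move=> tT; rewrite c_def mulVKf//.
  apply: ge_inf; last by exists t.
  set S := [set _ | _ in _] in c_def *.
  apply: contrapT => nolb; move: c_gt0; rewrite c_def inf_out ?mulr0 ?ltxx//.
  by case=> _.
have quad_ge t v : Theta t ->
    8 * c * l2norm v ^+ 2 <= (v *m covariance_matrix (P t) phi *m v^T) 0 0.
  move=> tT; have sym : (covariance_matrix (P t) phi)^T =
      covariance_matrix (P t) phi.
    by apply/matrixP => i j; rewrite !mxE covarianceC.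
  apply: le_trans (lambda_le_quadratic_form v sym).
  by rewrite ler_wpM2r ?sqr_ge0// lambda_ge.
(* The quadratic form at the i-th unit vector is the i-th diagonal entry of the
   covariance matrix, which is therefore positive. *)
have phi_L2 t i : Theta t -> (fun x => phi x 0 i) \in Lfun (P t) 2%:E.
  move=> tT; have [_ _ mphi _] := P_expfam.
  apply: variance_gt0_Lfun2 => //.
  have := quad_ge t (delta_mx 0 i) tT.
  rewrite -rowE trmx_delta -colE !mxE; apply: lt_le_trans.
  rewrite l2norm_sqr (bigD1 i)//= mxE !eqxx expr1n.
  by rewrite mulr_gt0 ?mulr_gt0// ltr_pwDl// sumr_ge0// => j _; exact: sqr_ge0.
pose psi := log_partition mu r phi.
pose x (t : R) := thetas + t *: h.
have xT t : 0 <= t -> t <= 1 -> Theta (x t).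
  by move=> t0 t1; exact: convex_set_segment.
have gap : 8 * c * l2norm h ^+ 2 / 4 <=
    psi (x 1) + psi (x 0) - 2 * psi (x 2^-1).
  apply: (@second_difference_ge _ (psi \o x)).
    by rewrite mulr_ge0 ?sqr_ge0// mulr_ge0// ltW.
  move=> m e e0 me0 me1 /=.
  have xD k : x (m + k) = x m + k *: h by rewrite /x scalerDl addrA.
  have mT : Theta (x m) by apply: xT; lra.
  have meT : Theta (x (m + e)) by apply: xT; lra.
  have meT' : Theta (x (m - e)) by apply: xT; lra.
  have := @log_partition_second_difference _ _ _ _ _ _ _ _ _ P_expfam
    (x m) (e *: h).
  rewrite -scaleNr -!xD => /(_ (fun i => phi_L2 _ i mT) mT meT meT').
  apply: le_trans.
  have := quad_ge _ (e *: h) mT; rewrite l2normZ_sqr mulrCA => le_quad.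
  have ge0 : 0 <= e ^+ 2 * (8 * c * l2norm h ^+ 2).
    by rewrite mulr_ge0 ?sqr_ge0// mulr_ge0 ?sqr_ge0// mulr_ge0// ltW.
  have pos : 0 < 1 + e ^+ 2 * (8 * c * l2norm h ^+ 2) by rewrite ltr_pwDl.
  by rewrite ler_ln ?posrE ?lerD2l// (lt_le_trans pos)// lerD2l.
have x0 : x 0 = thetas by rewrite /x scale0r addr0.
have x1 : x 1 = theta by rewrite /x scale1r /h addrC subrK.
rewrite (@hellinger_affinity_expfam _ _ _ _ _ _ _ _ _ P_expfam _ _ (x 2^-1)).
- rewrite lee_fin ler_expR -/psi -[in psi thetas]x0 -[in psi theta]x1.
  move: gap; move: (psi _) (psi _) (psi _) (l2norm h ^+ 2) => s1 s0 sm n.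
  lra.
- rewrite /x /h scalerBr [RHS]scalerDr addrCA [RHS]addrC; congr (_ + _).
  by rewrite -{1}[thetas]scale1r -scalerBl; congr (_ *: _); field.
- by apply: xT; rewrite ?invr_ge0 ?invf_le1 ?ler1n.
Qed.
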